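(* Consider three centroaffine curves $\gamma,\delta$ and $\Gamma$ such that $\Gamma$ is $b$-related to $\gamma$, i.e. $[\gamma,\Gamma]=b$, and $\delta$ is $c$-related to $\gamma$, i.e. $[\gamma,\delta]=c$. Then there exists a fourth centroaffine curve $\Delta$ that is $b$-related to $\delta$ (that is, $[\delta,\Delta]=b$) and $c$-related to $\Gamma$ (that is, $[\Gamma,\Delta]=c$). In fact, $\Delta(t)$ is the unique point such that $\delta(t)\,\gamma(t)\,\Gamma(t)\,\Delta(t)$ form a centroaffine butterfly.
   Context: For $u,v\in\mathbb{R}^2$, $[u,v]$ denotes the determinant of the matrix with columns $u,v$. A centroaffine curve is a smooth parametrized curve $\gamma:\mathbb{R}\to\mathbb{R}^2$ with $[\gamma(t),\gamma'(t)]=1$ for all $t$; unless specified otherwise, curves are assumed $\pi$-anti-periodic: $\gamma(t+\pi)=-\gamma(t)$ for all $t$. Two centroaffine curves $\gamma$ and $\delta$ are $c$-related if $[\gamma(t),\delta(t)]=c$ for all $t$, where $c$ is a constant. A quadrilateral $P_1P_2P_3P_4$ in $\mathbb{R}^2$ forms a centroaffine butterfly if $[P_1,P_2]=[P_4,P_3]$ and $[P_2,P_3]=[P_1,P_4]$.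
   Formalization: The uniqueness of the point Δ(t) is claimed only when Γ is neither δ nor −δ; in those two cases the butterfly condition is solved by a whole line of points, so uniqueness fails. The existence of Δ is proved in all cases. *)

(* Defs.v *)
From HB Require Import structures.
From mathcomp Require Import all_boot all_order all_algebra.
From mathcomp Require Import all_classical all_reals all_analysis.

Set Implicit Arguments.
Unset Strict Implicit.
Unset Printing Implicit Defensive.

Import Order.TTheory GRing.Theory Num.Theory.
Import numFieldNormedType.Exports.

Local Open Scope classical_set_scope.
Local Open Scope ring_scope.

(* [u, v]: the columns of the matrix are u and v. *)
Definition bracket (R : realType) (u v : 'cV[R]_2) : R :=
  \det (row_mx u v : 'M[R]_2).

(* C^oo: every iterated derivative is differentiable everywhere. The scope
   %classic selects the analytic derivative over that of {poly R}. *)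
Definition smooth (R : realType) (f : R -> 'cV[R]_2) : Prop :=
  forall (n : nat) (t : R), derivable (f^`(n))%classic t 1.

Definition pi_antiperiodic (R : realType) (f : R -> 'cV[R]_2) : Prop :=
  forall t : R, f (t + pi) = - f t.

(* Pi-anti-periodicity is a standing assumption on centroaffine curves, so it
   is part of the definition. *)
Definition centroaffine_curve (R : realType) (gamma : R -> 'cV[R]_2) : Prop :=
  [/\ smooth gamma,
      forall t : R, bracket (gamma t) ((gamma^`())%classic t) = 1 &
      pi_antiperiodic gamma].

(* The relation is oriented: exchanging the two curves changes the sign
   of c. *)
Definition c_related (R : realType) (c : R) (gamma delta : R -> 'cV[R]_2)
    : Prop :=
  forall t : R, bracket (gamma t) (delta t) = c.

Definition centroaffine_butterfly (R : realType) (P1 P2 P3 P4 : 'cV[R]_2)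
    : Prop :=
  bracket P1 P2 = bracket P4 P3 /\ bracket P2 P3 = bracket P1 P4.

(* Main.v *)
Require Import Defs.
From HB Require Import structures.
From mathcomp Require Import all_boot all_order all_algebra.
From mathcomp Require Import all_classical all_reals all_analysis.
From mathcomp Require Import ring lra.

Set Implicit Arguments.
Unset Strict Implicit.
Unset Printing Implicit Defensive.

Import Order.TTheory GRing.Theory Num.Theory.
Import numFieldNormedType.Exports.

Local Open Scope classical_set_scope.
Local Open Scope ring_scope.

(** The butterfly condition on P at time t says [delta, P] = b and
[Gamma, P] = c. Put D = [delta, Gamma]. Where D does not vanish, Cramer's rule
gives the unique solution Delta = (b Gamma - c delta) / D, so the point is that
[Delta, Delta'] = 1 and that D vanishes nowhere unless Gamma = delta or
Gamma = - delta.

Both follow by expanding everything in the frame (gamma, gamma'). Since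
[gamma, delta] = c, differentiating gives [gamma, delta'] = [delta, gamma'] = x,
so delta = x gamma + c gamma' and delta' = u gamma + x gamma'; the relation
[delta, delta'] = 1 reads x^2 = 1 + c u, and in the same way
Gamma = y gamma + b gamma' and Gamma' = z gamma + y gamma' with y^2 = 1 + b z.
Then D = b x - c y and D' = b u - c z, and eliminating u and z yields both

- [b Gamma - c delta, b Gamma' - c delta'] = D^2, which is [Delta, Delta'] = 1
  after division by D^2 ([bracket_numerators]);
- b c D' = (b x + c y) D + (c^2 - b^2), a linear differential equation for D.

Suppose now that D vanishes somewhere and b c <> 0. As gamma, delta, Gamma are
pi-anti-periodic, D is pi-periodic, hence it vanishes twice. An integrating
factor turns D into a function whose derivative has the constant sign of
(c^2 - b^2) / (b c), so two zeros force c^2 = b^2 ([linear_ode_two_zeros]); the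
equation is then homogeneous and D vanishes identically ([linear_ode_zero]).
With b = c or b = - c and b x = c y this means Gamma = delta or
Gamma = - delta. If b c = 0, then D = 0 at one point forces b = c = 0, so that
delta = x gamma and Gamma = y gamma with x and y constant signs, and the same
conclusion holds ([bracket_neq0]).

In the two remaining cases D is identically zero and an explicit curve works:
Delta = - gamma if Gamma = delta, and Delta = gamma if Gamma = - delta. *)

(** * Determinants of pairs of plane vectors *)

Lemma bracketE (R : realType) (u v : 'cV[R]_2) :
  bracket u v = u 0 0 * v 1 0 - u 1 0 * v 0 0.
Proof.
have det2 (A : 'M[R]_2) : \det A = A 0 0 * A 1 1 - A 1 0 * A 0 1.
  rewrite (expand_det_row _ 0) !big_ord_recl big_ord0 addr0.
  rewrite /cofactor !det_mx11 !mxE /=.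
  have -> : lift (0 : 'I_2) (0 : 'I_1) = 1 by apply: val_inj.
  have -> : lift (1 : 'I_2) (0 : 'I_1) = 0 by apply: val_inj.
  by rewrite /bump /= addn0 expr0 expr1; ring.
have lE i : row_mx u v i 0 = u i 0.
  by rewrite (_ : 0 = lshift 1 (0 : 'I_1)) ?row_mxEl //; exact: val_inj.
have rE i : row_mx u v i 1 = v i 0.
  by rewrite (_ : 1 = rshift 1 (0 : 'I_1)) ?row_mxEr //; exact: val_inj.
by rewrite /bracket det2 !lE !rE.
Qed.

Lemma bracketC (R : realType) (u v : 'cV[R]_2) : bracket u v = - bracket v u.
Proof. by rewrite !bracketE; ring. Qed.

Lemma bracketNl (R : realType) (u v : 'cV[R]_2) :
  bracket (- u) v = - bracket u v.
Proof. by rewrite !bracketE !mxE; ring. Qed.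

Lemma bracketNr (R : realType) (u v : 'cV[R]_2) :
  bracket u (- v) = - bracket u v.
Proof. by rewrite !bracketE !mxE; ring. Qed.

Lemma cV2P (R : realType) (u v : 'cV[R]_2) :
  u 0 0 = v 0 0 -> u 1 0 = v 1 0 -> u = v.
Proof.
move=> e0 e1; apply/matrixP => i j; rewrite (ord1 j).
case: i => [[|[|//]] lti]; first by rewrite (_ : Ordinal lti = 0) //;
  exact: val_inj.
by rewrite (_ : Ordinal lti = 1) //; exact: val_inj.
Qed.

(** Cramer's rule, without a division so that it also covers collinear u and v:
three vectors of a plane are always dependent, with these coefficients. *)
Lemma bracket_cramer (R : realType) (u v w : 'cV[R]_2) :
  bracket u v *: w = bracket u w *: v - bracket v w *: u.
Proof. by apply: cV2P; rewrite !mxE !bracketE; ring. Qed.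

(** The Pluecker relation for four plane vectors: [v, h] and [g, v] are the
coordinates of v in a unimodular frame (g, h), and the bracket of two vectors is
the determinant of their coordinates. *)
Lemma bracket_frame (R : realType) (g h v w : 'cV[R]_2) : bracket g h = 1 ->
  bracket v w = bracket v h * bracket g w - bracket g v * bracket w h.
Proof. by move=> gh1; rewrite -[LHS]mul1r -gh1 !bracketE; ring. Qed.

(** * Differentiating brackets *)

Lemma is_derive_col (R : realType) (f : R -> 'cV[R]_2) (t : R) (i : 'I_2) :
  derivable f t 1 ->
  is_derive t 1 (fun s => f s i 0) ((f^`())%classic t i 0).
Proof.
move=> df; apply: DeriveDef; first exact: (derivable_mxP _ _ _).1.
by rewrite derive1E derive_mx // mxE.
Qed.

Lemma is_derive_bracket (R : realType) (f g : R -> 'cV[R]_2) (t : R) :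
  derivable f t 1 -> derivable g t 1 ->
  is_derive t 1 (fun s => bracket (f s) (g s))
    (bracket ((f^`())%classic t) (g t) + bracket (f t) ((g^`())%classic t)).
Proof.
move=> df dg.
have f0 := is_derive_col 0 df; have f1 := is_derive_col 1 df.
have g0 := is_derive_col 0 dg; have g1 := is_derive_col 1 dg.
rewrite (_ : (fun s => bracket (f s) (g s)) =
    (fun s => f s 0 0) * (fun s => g s 1 0) -
    (fun s => f s 1 0) * (fun s => g s 0 0)).
  by apply: is_derive_eq; rewrite !bracketE /GRing.scale /=; ring.
by apply/funext => s; rewrite bracketE.
Qed.

Lemma derivable_continuous (R : realType) (f : R -> R) :
  (forall t : R, derivable f t 1) -> continuous f.
Proof. by move=> df t; apply/differentiable_continuous/derivable1_diffP. Qed.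

(** * First-order linear differential equations *)

Lemma continuous_primitive (R : realType) (g : R -> R) (u v : R) :
  continuous g -> u < v ->
  exists G : R -> R, forall t : R, u < t < v -> is_derive t 1 G (g t).
Proof.
move=> cg uv.
exists (fun y => \int[lebesgue_measure]_(s in `[u, y]) g s)%R => t /andP[ut tv].
have ig : (@lebesgue_measure R).-integrable `[u, v] (EFin \o g).
  apply: continuous_compact_integrable; first exact: segment_compact.
  exact: continuous_subspaceT.
have [dG G'] := continuous_FTC1_closed tv ig ut (cg t).
by apply: DeriveDef; [exact: dG|rewrite -derive1E; exact: G'].
Qed.

(** The mean value theorem for m D, where m = exp (- G) is an integrating
factor with G' = g: then (m D)' = k m. The numbers p, q, r are m t, m s and
m taken at the intermediate point times t - s; only their signs matter below,
which is why m itself is not exposed. *)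
Lemma linear_ode_increment (R : realType) (D g : R -> R) (k s t : R) :
  continuous g -> (forall r : R, is_derive r 1 D (g r * D r + k)) -> s < t ->
  exists p q r : R, [/\ 0 < p, 0 < q, 0 < r & p * D t - q * D s = k * r].
Proof.
move=> cg dD st.
(* The margin 1 makes G differentiable, hence continuous, on all of [s, t]. *)
have [|G dG] := @continuous_primitive _ g (s - 1) (t + 1) cg; first lra.
pose m r := expR (- G r).
have dmD (r : R) : s - 1 < r < t + 1 ->
    is_derive r 1 (fun r => m r * D r) (m r * k).
  move=> /dG dGr.
  have dN : is_derive r 1 (- G) (- g r) by exact: is_deriveN.
  have dm : is_derive r 1 m (expR (- G r) * - g r) by exact: is_derive1_comp.
  have := is_deriveM dm (dD r); rewrite /GRing.scale /=.
  by move/is_derive_eq; apply; rewrite /m; ring.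
have [r rst e] : exists2 r, r \in `]s, t[%R &
    m t * D t - m s * D s = m r * k * (t - s).
  apply: (MVT (f := fun r => m r * D r) st) => [r|].
    by rewrite in_itv /= => /andP[sr rt]; apply: dmD; lra.
  apply: derivable_within_continuous => r.
  by rewrite in_itv /= => /andP[sr rt]; apply: ex_derive; apply: dmD; lra.
exists (m t), (m s), (m r * (t - s)).
by split; rewrite ?mulr_gt0 ?expR_gt0 ?subr_gt0 // e; ring.
Qed.

Lemma linear_ode_zero (R : realType) (D g : R -> R) (s t : R) :
  continuous g -> (forall r : R, is_derive r 1 D (g r * D r)) ->
  D s = 0 -> D t = 0.
Proof.
move=> cg dD Ds0.
have dD0 (r : R) : is_derive r 1 D (g r * D r + 0) by rewrite addr0.
case: (ltgtP s t) => [st|ts|<- //].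
- have [p [q [r [p0 _ _]]]] := linear_ode_increment cg dD0 st.
  rewrite Ds0 mulr0 subr0 mul0r => /eqP.
  by rewrite mulf_eq0 gt_eqF //= => /eqP.
- have [p [q [r [_ q0 _]]]] := linear_ode_increment cg dD0 ts.
  rewrite Ds0 mulr0 sub0r mul0r => /eqP.
  by rewrite oppr_eq0 mulf_eq0 gt_eqF //= => /eqP.
Qed.

(** After multiplication by an integrating factor D is strictly monotone unless
k = 0. *)
Lemma linear_ode_two_zeros (R : realType) (D g : R -> R) (k s t : R) :
  continuous g -> (forall r : R, is_derive r 1 D (g r * D r + k)) -> s < t ->
  D s = 0 -> D t = 0 -> k = 0.
Proof.
move=> cg dD st Ds0 Dt0.
have [p [q [r [_ _ r0]]]] := linear_ode_increment cg dD st.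
rewrite Ds0 Dt0 !mulr0 subr0 => /esym/eqP.
by rewrite mulf_eq0 [r == 0]gt_eqF // orbF => /eqP.
Qed.

(** Differentiating f^2 = 1 gives f f' = 0, and f has no zero. *)
Lemma sqr_eq1_constant (R : realType) (f : R -> R) (s t : R) :
  (forall r : R, derivable f r 1) -> (forall r : R, f r ^+ 2 = 1) -> f s = f t.
Proof.
move=> df f2; apply: is_derive_0_is_cst => r.
have := derivableP (df r); set f' := 'D_1 f r => df'.
have fr0 : f r != 0.
  apply/eqP => fr0; move: (f2 r); rewrite fr0 expr0n => /eqP.
  by rewrite eq_sym oner_eq0.
have f'0 : f r * f' = 0.
  have dff := is_deriveM df' df'.
  have ff1 : f * f = cst 1 by apply/funext => a; rewrite -(f2 a) expr2.
  have dcst : is_derive r 1 (f * f) 0 by rewrite ff1; exact: is_derive_cst.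
  have := derive_val (is_derive := dff).
  rewrite (derive_val (is_derive := dcst)) /GRing.scale /=.
  lra.
by move/eqP: f'0; rewrite mulf_eq0 (negbTE fr0) /= => /eqP f'0; rewrite -f'0.
Qed.

(** * Closure properties of smooth functions *)

(** Smoothness is proved order by order because the derivatives of a product or
of an inverse involve the functions themselves again: passing to order n.+1
takes the closure property at order n for all functions. The derivative is
peeled off first, f' before its higher derivatives, to fit this induction. *)
Fixpoint times_derivable (R : realType) (V : normedModType R) (n : nat)
    (f : R -> V) : Prop :=
  if n is m.+1 then
    (forall t : R, derivable f t 1) /\ times_derivable m (f^`())%classic
  else True.

Lemma times_derivableW (R : realType) (V : normedModType R) n (f : R -> V) :
  times_derivable n.+1 f -> times_derivable n f.
Proof. by elim: n f => [|n IHn] f // [df /IHn df']. Qed.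

Lemma times_derivable_col (R : realType) n (f : R -> 'cV[R]_2) :
  times_derivable n f <->
  forall i, times_derivable n (fun t => f t i 0 : R).
Proof.
elim: n f => [|n IHn] f; first by split.
have col' i : (forall t : R, derivable f t 1) ->
    ((fun t => f t i 0 : R)^`())%classic = fun t => (f^`())%classic t i 0.
  move=> df; apply/funext => t; have fi := is_derive_col i (df t).
  by rewrite derive1E (derive_val (is_derive := fi)).
split=> [[df /IHn df'] i|dfi].
  split=> [t|]; first exact: (derivable_mxP _ _ _).1.
  by rewrite col'; first exact: df'.
have df (t : R) : derivable f t 1.
  by apply/derivable_mxP => i j; rewrite (ord1 j); case: (dfi i).
split; first exact: df.
by apply/IHn => i; rewrite -col'; first by case: (dfi i).
Qed.

Lemma times_derivableD (R : realType) n (f g : R -> R) :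
  times_derivable n f -> times_derivable n g -> times_derivable n (f + g).
Proof.
elim: n f g => [//|n IHn] f g [df df'] [dg dg'].
split=> [t|]; first exact: (derivableD (df t) (dg t)).
rewrite (_ : (f + g)^`()%classic = f^`()%classic + g^`()%classic).
  exact: (IHn _ _ df' dg').
by apply/funext => t; rewrite derive1E (deriveD (df t) (dg t)) -!derive1E.
Qed.

Lemma times_derivableM (R : realType) n (f g : R -> R) :
  times_derivable n f -> times_derivable n g -> times_derivable n (f * g).
Proof.
elim: n f g => [//|n IHn] f g sf sg; have [df df'] := sf; have [dg dg'] := sg.
split=> [t|]; first exact: (derivableM (df t) (dg t)).
rewrite (_ : (f * g)^`()%classic = f * g^`()%classic + g * f^`()%classic).
  apply: times_derivableD; first exact: (IHn _ _ (times_derivableW sf) dg').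
  exact: (IHn _ _ (times_derivableW sg) df').
by apply/funext => t; rewrite derive1E (deriveM (df t) (dg t)) -!derive1E.
Qed.

Lemma times_derivable_cst (R : realType) n (k : R) :
  times_derivable n (fun _ : R => k).
Proof.
elim: n k => [//|n IHn] k.
split=> [t|]; first exact: derivable_cst.
rewrite (_ : _^`()%classic = fun=> 0); first exact: IHn.
by apply/funext => t; rewrite derive1_cst.
Qed.

(** In (1 / f)' = - (1 / f)^2 f' the factors only need one order less. *)
Lemma times_derivableV (R : realType) n (f : R -> R) :
  (forall t, f t != 0) -> times_derivable n f ->
  times_derivable n (fun t => (f t)^-1).
Proof.
move=> f0; elim: n => [//|n IHn] sf; have [df df'] := sf.
have sV := IHn (times_derivableW sf).
split=> [t|]; first exact: (derivableV (f0 t) (df t)).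
rewrite (_ : _^`()%classic =
  (fun=> -1) * ((fun t => (f t)^-1) * (fun t => (f t)^-1)) * f^`()%classic).
  apply: times_derivableM df'; apply: times_derivableM.
    exact: times_derivable_cst.
  exact: (times_derivableM sV sV).
apply/funext => t; rewrite derive1E (deriveV (f0 t) (df t)) -derive1E.
by rewrite -exprVn expr2 /GRing.scale /= mulN1r.
Qed.

Lemma smooth_derivable (R : realType) (f : R -> 'cV[R]_2) :
  smooth f -> forall t : R, derivable f t 1.
Proof. by move=> sf; exact: (sf 0%N). Qed.
Arguments smooth_derivable {R f} _ _.

Lemma smooth_derive1 (R : realType) (f : R -> 'cV[R]_2) :
  smooth f -> smooth (f^`())%classic.
Proof. by move=> sf n t; rewrite -derive1Sn; exact: sf. Qed.

Lemma smoothP (R : realType) (f : R -> 'cV[R]_2) :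
  smooth f <-> forall n i, times_derivable n (fun t => f t i 0 : R).
Proof.
have -> : (forall n i, times_derivable n (fun t => f t i 0 : R)) <->
    (forall n, times_derivable n f).
  by split=> df n; apply/times_derivable_col.
split=> [sf n|df n t].
  elim: n f sf => [//|n IHn] f sf; split; first exact: smooth_derivable sf.
  exact/IHn/smooth_derive1.
elim: n f {df}(df n.+1) => [|n IHn] f [df df']; first exact: df.
by rewrite derive1Sn; exact: IHn.
Qed.

Lemma smooth_lincomb (R : realType) (p q : R -> R) (f g : R -> 'cV[R]_2) :
  (forall n, times_derivable n p) -> (forall n, times_derivable n q) ->
  smooth f -> smooth g -> smooth (fun t => p t *: f t + q t *: g t).
Proof.
move=> sp sq /smoothP sf /smoothP sg; apply/smoothP => n i.
rewrite (_ : (fun t => _) = p * (fun t => f t i 0) + q * (fun t => g t i 0)).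
  apply: times_derivableD; first exact: (times_derivableM (sp n) (sf n i)).
  exact: (times_derivableM (sq n) (sg n i)).
by apply/funext => t; rewrite !mxE.
Qed.

Lemma times_derivable_bracket (R : realType) n (f g : R -> 'cV[R]_2) :
  smooth f -> smooth g -> times_derivable n (fun t => bracket (f t) (g t)).
Proof.
move=> /smoothP sf /smoothP sg.
rewrite (_ : (fun t => _) = (fun t => f t 0 0) * (fun t => g t 1 0) +
    (fun=> -1) * ((fun t => f t 1 0) * (fun t => g t 0 0))).
  apply: times_derivableD; first exact: (times_derivableM (sf n 0) (sg n 1)).
  apply: times_derivableM; first exact: times_derivable_cst.
  exact: (times_derivableM (sf n 1) (sg n 0)).
by apply/funext => t; rewrite bracketE; congr (_ + _); rewrite -[LHS]mulN1r.
Qed.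

(** * Brackets of two curves related to a third one *)

(** Differentiate [f, g] = k. *)
Lemma c_related_derive (R : realType) (k : R) (f g : R -> 'cV[R]_2) (t : R) :
  smooth f -> smooth g -> c_related k f g ->
  bracket (f t) (g^`()%classic t) = bracket (g t) (f^`()%classic t).
Proof.
move=> sf sg fg.
have := is_derive_bracket (smooth_derivable sf t) (smooth_derivable sg t).
rewrite (_ : (fun s => _) = cst k); last by apply/funext => s; rewrite fg.
move=> dk; have := derive_val (is_derive := dk).
rewrite derive_cst => /esym/eqP; rewrite addrC addr_eq0 => /eqP ->.
by rewrite -bracketC.
Qed.

(** In the frame (gamma, gamma') a curve f with [gamma, f] = k has coordinates
[f, gamma'] and k, and its derivative has coordinates [f', gamma'] and
[gamma, f'] = [f, gamma']. *)
Section RelatedCurves.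
Context (R : realType) (gamma : R -> 'cV[R]_2).
Context (sgamma : smooth gamma)
  (gamma1 : forall t, bracket (gamma t) (gamma^`()%classic t) = 1).

Lemma c_related_riccati (k : R) (f : R -> 'cV[R]_2) (t : R) :
  smooth f -> bracket (f t) (f^`()%classic t) = 1 -> c_related k gamma f ->
  bracket (f t) (gamma^`()%classic t) ^+ 2 =
  1 + k * bracket (f^`()%classic t) (gamma^`()%classic t).
Proof.
move=> sf f1 gf; have := bracket_frame (f t) (f^`()%classic t) (gamma1 t).
rewrite f1 (c_related_derive _ sgamma sf gf) gf => /esym/eqP.
by rewrite subr_eq -expr2 => /eqP.
Qed.

Lemma c_related_bracket (k l : R) (f g : R -> 'cV[R]_2) (t : R) :
  c_related k gamma f -> c_related l gamma g ->
  bracket (f t) (g t) =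
  l * bracket (f t) (gamma^`()%classic t) -
  k * bracket (g t) (gamma^`()%classic t).
Proof. by move=> gf gg; rewrite (bracket_frame _ _ (gamma1 t)) gf gg; ring. Qed.

Lemma c_related_bracket_derive (k l : R) (f g : R -> 'cV[R]_2) (t : R) :
  smooth f -> c_related k gamma f -> c_related l gamma g ->
  bracket (f^`()%classic t) (g t) =
  l * bracket (f^`()%classic t) (gamma^`()%classic t) -
  bracket (f t) (gamma^`()%classic t) * bracket (g t) (gamma^`()%classic t).
Proof.
move=> sf gf gg.
rewrite (bracket_frame (f^`()%classic t) _ (gamma1 t)).
by rewrite (c_related_derive _ sgamma sf gf) gg; ring.
Qed.

Lemma c_related_coords (k : R) (f : R -> 'cV[R]_2) (t : R) :
  c_related k gamma f ->
  f t =
  bracket (f t) (gamma^`()%classic t) *: gamma t + k *: gamma^`()%classic t.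
Proof.
move=> gf; have := bracket_cramer (gamma t) (gamma^`()%classic t) (f t).
rewrite gamma1 scale1r gf => {1}->.
by rewrite [bracket (derive1 _ _) _]bracketC scaleNr opprK addrC.
Qed.

Context (b c : R) (delta Gamma : R -> 'cV[R]_2).
Context (sdelta : smooth delta) (sGamma : smooth Gamma)
  (delta1 : forall t, bracket (delta t) (delta^`()%classic t) = 1)
  (Gamma1 : forall t, bracket (Gamma t) (Gamma^`()%classic t) = 1)
  (hb : c_related b gamma Gamma) (hc : c_related c gamma delta).

(** With the notation of the introductory comment, the left side is
b^2 + c^2 - b c (2 x y - b u - c z). Replacing b z and c u by y^2 - 1 and
x^2 - 1 turns it into (b x - c y)^2. *)
Lemma bracket_numerators t :
  bracket (b *: Gamma t - c *: delta t)
    (b *: Gamma^`()%classic t - c *: delta^`()%classic t) =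
  bracket (delta t) (Gamma t) ^+ 2.
Proof.
have bilin (p q p' q' : 'cV[R]_2) :
    bracket (b *: p - c *: q) (b *: p' - c *: q') =
    b ^+ 2 * bracket p p' + c ^+ 2 * bracket q q' +
    b * c * (bracket p' q + bracket q' p).
  by rewrite !bracketE !mxE; ring.
rewrite bilin Gamma1 delta1.
rewrite (c_related_bracket_derive _ sdelta hc hb).
rewrite (c_related_bracket_derive _ sGamma hb hc) (c_related_bracket _ hc hb).
have := c_related_riccati sdelta (delta1 t) hc.
have := c_related_riccati sGamma (Gamma1 t) hb.
set y := bracket (Gamma t) _; set x := bracket (delta t) _.
set z := bracket _ _; set u := bracket _ _.
move: y x z u => y x z u y2 x2.
transitivity (b ^+ 2 * (1 + c * u) + c ^+ 2 * (1 + b * z) - 2 * b * c * x * y).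
  by ring.
by rewrite -x2 -y2; ring.
Qed.

(** With the notation of the introductory comment, D' = b u - c z, so that
b c D' = b^2 (x^2 - 1) - c^2 (y^2 - 1), and the squares factor through
D = b x - c y. *)
Lemma is_derive_bracket_c_related (t : R) : b * c != 0 ->
  is_derive t 1 (fun s => bracket (delta s) (Gamma s))
    ((b * bracket (delta t) (gamma^`()%classic t) +
      c * bracket (Gamma t) (gamma^`()%classic t)) / (b * c) *
     bracket (delta t) (Gamma t) + (c ^+ 2 - b ^+ 2) / (b * c)).
Proof.
move=> bc0.
have := is_derive_bracket (smooth_derivable sdelta t)
  (smooth_derivable sGamma t).
move/is_derive_eq; apply.
rewrite [bracket _ (Gamma^`()%classic t)]bracketC (c_related_bracket _ hc hb).
rewrite (c_related_bracket_derive _ sdelta hc hb).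
rewrite (c_related_bracket_derive _ sGamma hb hc).
have := c_related_riccati sdelta (delta1 t) hc.
have := c_related_riccati sGamma (Gamma1 t) hb.
set y := bracket (Gamma t) _; set x := bracket (delta t) _.
set z := bracket _ _; set u := bracket _ _.
move: y x z u => y x z u y2 x2.
apply: (mulfI bc0).
transitivity (b ^+ 2 * (1 + c * u) - c ^+ 2 * (1 + b * z) + c ^+ 2 - b ^+ 2).
  by ring.
rewrite -x2 -y2; move: bc0; rewrite mulf_eq0 negb_or => /andP[b0 c0].
by field; rewrite b0 c0.
Qed.

(** A zero of D = [delta, Gamma] recurs after pi; the differential equation then
forces b^2 = c^2 and D = 0 everywhere, which leaves only Gamma = delta and
Gamma = - delta. When b c = 0 there is no differential equation, but D can only
vanish if b = c = 0, and then delta and Gamma are constant multiples of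
gamma. *)
Lemma bracket_neq0 :
  pi_antiperiodic delta -> pi_antiperiodic Gamma ->
  Gamma <> delta -> Gamma <> (fun t => - delta t) ->
  forall t, bracket (delta t) (Gamma t) != 0.
Proof.
move=> dpi Gpi Gd GNd t; apply/eqP.
pose D s := bracket (delta s) (Gamma s); rewrite -/(D t) => Dt0.
pose x s := bracket (delta s) (gamma^`()%classic s).
pose y s := bracket (Gamma s) (gamma^`()%classic s).
have DE s : D s = b * x s - c * y s by exact: (c_related_bracket s hc hb).
have Gd_xy : b = c -> (forall s, x s = y s) -> False.
  move=> bc xy; apply: Gd; apply/funext => s.
  rewrite (c_related_coords s hb) (c_related_coords s hc).
  by rewrite -/(x s) -/(y s) xy bc.
have GNd_xy : b = - c -> (forall s, y s = - x s) -> False.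
  move=> bc xy; apply: GNd; apply/funext => s.
  rewrite (c_related_coords s hb) (c_related_coords s hc).
  by rewrite -/(x s) -/(y s) xy bc opprD !scaleNr.
have dx (s : R) : derivable x s 1.
  have [dxs _] := is_derive_bracket (smooth_derivable sdelta s)
    (smooth_derivable (smooth_derive1 sgamma) s).
  exact: dxs.
have dy (s : R) : derivable y s 1.
  have [dys _] := is_derive_bracket (smooth_derivable sGamma s)
    (smooth_derivable (smooth_derive1 sgamma) s).
  exact: dys.
have x2 s : x s ^+ 2 = 1 + c * _ := c_related_riccati sdelta (delta1 s) hc.
have y2 s : y s ^+ 2 = 1 + b * _ := c_related_riccati sGamma (Gamma1 s) hb.
have [bc0|bc0] := eqVneq (b * c) 0.
  (* If one of b, c is 0, the corresponding y or x is a sign, and b x = c y. *)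
  have [b0 c0] : b = 0 /\ c = 0.
    move: (DE t) (x2 t) (y2 t); rewrite Dt0.
    move/eqP: bc0; rewrite mulf_eq0 => /orP[] /eqP b0c0; rewrite b0c0.
      rewrite !mul0r sub0r addr0 => /esym/eqP.
      rewrite oppr_eq0 mulf_eq0 => /orP[/eqP //|/eqP y0] _.
      by move/eqP; rewrite y0 expr0n eq_sym oner_eq0.
    rewrite !mul0r subr0 addr0 => /esym/eqP.
    rewrite mulf_eq0 => /orP[/eqP //|/eqP x0].
    by move/eqP; rewrite x0 expr0n eq_sym oner_eq0.
  have x1 s : x s ^+ 2 = 1 by rewrite x2 c0 mul0r addr0.
  have y1 s : y s ^+ 2 = 1 by rewrite y2 b0 mul0r addr0.
  have x_cst s : x s = x 0 := sqr_eq1_constant s 0 dx x1.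
  have y_cst s : y s = y 0 := sqr_eq1_constant s 0 dy y1.
  have : y 0 ^+ 2 = x 0 ^+ 2 by rewrite x1 y1.
  move/eqP; rewrite eqf_sqr => /orP[] /eqP xy.
    by apply: Gd_xy => [|s]; [rewrite b0 c0|rewrite x_cst y_cst xy].
  by apply: GNd_xy => [|s]; [rewrite b0 c0 oppr0|rewrite x_cst y_cst xy].
pose g s := (b * x s + c * y s) / (b * c).
have cg : continuous g.
  apply: derivable_continuous => s.
  have -> : g = (b * c)^-1 \*: (b \*: x + c \*: y).
    by apply/funext => r; rewrite /g mulrC.
  exact: derivableZ (derivableD (derivableZ (dx s)) (derivableZ (dy s))).
have Dpi s : D (s + pi) = D s.
  by rewrite /D dpi Gpi bracketNl bracketNr opprK.
have dD (s : R) : is_derive s 1 D (g s * D s + (c ^+ 2 - b ^+ 2) / (b * c)).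
  exact: is_derive_bracket_c_related.
have k0 : (c ^+ 2 - b ^+ 2) / (b * c) = 0.
  have tpi : t < t + pi by rewrite ltrDl pi_gt0.
  by apply: (linear_ode_two_zeros cg dD tpi Dt0); rewrite Dpi.
have D0 s : D s = 0.
  apply: (linear_ode_zero s cg _ Dt0) => r.
  by have := dD r; rewrite k0 addr0.
move: (bc0); rewrite mulf_eq0 negb_or => /andP[_ c0].
have : b ^+ 2 = c ^+ 2.
  move/eqP: k0; rewrite mulf_eq0 invr_eq0 (negbTE bc0) orbF subr_eq0.
  by move/eqP.
move/eqP; rewrite eqf_sqr => /orP[] /eqP bc.
  apply: Gd_xy => // s; apply: (mulfI c0).
  by move: (D0 s); rewrite DE bc => /eqP; rewrite subr_eq0 => /eqP.
apply: GNd_xy => // s; apply: (mulfI c0).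
by move: (D0 s); rewrite DE bc => /eqP; rewrite subr_eq0 mulNr mulrN => /eqP.
Qed.

End RelatedCurves.

(** * The fourth curve *)

Lemma centroaffine_curveN (R : realType) (f : R -> 'cV[R]_2) :
  centroaffine_curve f -> centroaffine_curve (fun t => - f t).
Proof.
move=> [sf f1 fpi]; split=> [|t|t].
- rewrite (_ : (fun t => - f t) = fun t => -1 *: f t + 0 *: f t).
    by apply: smooth_lincomb => // n; exact: times_derivable_cst.
  by apply/funext => t; rewrite scaleN1r scale0r addr0.
- have df := smooth_derivable sf t.
  rewrite [X in bracket _ X](_ : _ = - f^`()%classic t).
    by rewrite bracketNl bracketNr opprK f1.
  by rewrite !derive1E -[RHS](deriveN df).
- by rewrite fpi.
Qed.

(** The term of Delta' that contains (1 / D)' is a multiple of N, so it does not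
contribute to [Delta, Delta'] = [N, N'] / D^2. *)
Lemma centroaffine_curve_quotient (R : realType)
    (N : R -> 'cV[R]_2) (D : R -> R) :
  smooth N -> (forall n, times_derivable n D) -> (forall t, D t != 0) ->
  (forall t, bracket (N t) (N^`()%classic t) = D t ^+ 2) ->
  (forall t, N (t + pi) = - N t) -> (forall t, D (t + pi) = D t) ->
  centroaffine_curve (fun t => (D t)^-1 *: N t).
Proof.
move=> sN sD D0 NN Npi Dpi.
have sDV n : times_derivable n (fun t => (D t)^-1) by exact: times_derivableV.
have sDelta : smooth (fun t => (D t)^-1 *: N t).
  rewrite (_ : (fun t => _) = fun t => (D t)^-1 *: N t + 0 *: N t).
    by apply: smooth_lincomb => // n; exact: times_derivable_cst.
  by apply/funext => t; rewrite scale0r addr0.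
split=> // t; last by rewrite Npi Dpi scalerN.
have [dD _] := sDV 1%N; have {}dD := dD t.
have dDelta i : (fun t => (D t)^-1 *: N t)^`()%classic t i 0 =
    (D t)^-1 * N^`()%classic t i 0 + N t i 0 * 'D_1 (fun t => (D t)^-1) t.
  have := is_derive_col i (smooth_derivable sDelta t).
  have := is_deriveM (derivableP dD) (is_derive_col i (smooth_derivable sN t)).
  rewrite (_ : (fun s => ((D s)^-1 *: N s) i 0) =
    (fun s => (D s)^-1) * (fun s => N s i 0)).
    move=> d1 d2; rewrite -(derive_val (is_derive := d2)).
    by rewrite (derive_val (is_derive := d1)).
  by apply/funext => s; rewrite mxE.
rewrite bracketE !dDelta !mxE.
transitivity ((D t) ^- 2 * bracket (N t) (N^`()%classic t)).
  by rewrite bracketE -exprVn; ring.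
by rewrite NN mulVf // expf_neq0.
Qed.

(* If Gamma is delta or - delta, the butterfly condition at each t is solved by
   a whole line of points, so pointwise uniqueness is claimed exactly outside
   of this case; everything else is unconditional. *)
Theorem theorem9 (R : realType) (b c : R)
    (gamma delta Gamma : R -> 'cV[R]_2)
    (hgamma : centroaffine_curve gamma)
    (hdelta : centroaffine_curve delta)
    (hGamma : centroaffine_curve Gamma)
    (hb : c_related b gamma Gamma)
    (hc : c_related c gamma delta) :
  exists Delta : R -> 'cV[R]_2,
    [/\ centroaffine_curve Delta,
        c_related b delta Delta,
        c_related c Gamma Delta,
        forall t : R,
          centroaffine_butterfly (delta t) (gamma t) (Gamma t) (Delta t) &
        Gamma <> delta -> Gamma <> (fun t : R => - delta t) ->
        forall (t : R) (P : 'cV[R]_2),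
          centroaffine_butterfly (delta t) (gamma t) (Gamma t) P ->
          P = Delta t].
Proof.
have butterflyP t P : centroaffine_butterfly (delta t) (gamma t) (Gamma t) P <->
    bracket (delta t) P = b /\ bracket (Gamma t) P = c.
  rewrite /centroaffine_butterfly bracketC [bracket P _]bracketC hc hb.
  by split=> [[/oppr_inj -> ->]|[-> ->]].
suff [Delta [cDelta bDelta uDelta]] : exists Delta : R -> 'cV[R]_2,
    [/\ centroaffine_curve Delta,
        forall t, bracket (delta t) (Delta t) = b /\
          bracket (Gamma t) (Delta t) = c &
        Gamma <> delta -> Gamma <> (fun t => - delta t) ->
        forall t P, bracket (delta t) P = b /\ bracket (Gamma t) P = c ->
          P = Delta t].
  exists Delta; split=> // [t|t|t|n1 n2 t P /butterflyP];
    try by case: (bDelta t).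
    exact/butterflyP.
  exact: uDelta.
have [Gd|Gd] := pselect (Gamma = delta).
  have bc : b = c by rewrite -(hb 0) -(hc 0) Gd.
  exists (fun t => - gamma t); split=> // [|t].
    exact: centroaffine_curveN.
  by rewrite !bracketNr -!bracketC hb hc bc.
have [GNd|GNd] := pselect (Gamma = fun t => - delta t).
  have bc : b = - c by rewrite -(hb 0) -(hc 0) GNd bracketNr.
  exists gamma; split=> // t.
  by rewrite bracketC hc [bracket (Gamma t) _]bracketC hb bc opprK.
pose D t := bracket (delta t) (Gamma t).
pose N t := b *: Gamma t - c *: delta t.
case: hgamma hdelta hGamma =>
  sgamma gamma1 _ [sdelta delta1 dpi] [sGamma Gamma1 Gpi].
have D0 t : D t != 0.
  exact: (bracket_neq0 sgamma gamma1 sdelta sGamma delta1 Gamma1 hb hc).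
exists (fun t => (D t)^-1 *: N t); split.
- apply: centroaffine_curve_quotient => [|n|t|t|t|t].
  + rewrite (_ : N = fun t => b *: Gamma t + (- c) *: delta t).
      by apply: smooth_lincomb => // n; exact: times_derivable_cst.
    by apply/funext => t; rewrite scaleNr.
  + exact: times_derivable_bracket.
  + exact: D0.
  + have dd := smooth_derivable sdelta t; have dG := smooth_derivable sGamma t.
    rewrite -(bracket_numerators sgamma gamma1 sdelta sGamma delta1 Gamma1
      hb hc) derive1E.
    rewrite (_ : N = b \*: Gamma - c \*: delta) //.
    have -> : 'D_1 (b \*: Gamma - c \*: delta) t =
        b *: (Gamma^`())%classic t - c *: (delta^`())%classic t.
      rewrite (deriveB (derivableZ dG) (derivableZ dd)).
      by rewrite (deriveZ b dG) (deriveZ c dd) -!derive1E.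
    by [].
  + by rewrite /N dpi Gpi !scalerN opprD.
  + by rewrite /D dpi Gpi bracketNl bracketNr opprK.
- move=> t; split; apply: (mulfI (D0 t)); rewrite /N /D !bracketE !mxE;
    field; by move: (D0 t); rewrite /D bracketE.
- move=> _ _ t P [dP GP]; apply: (scalerI (D0 t)).
  by rewrite scalerA divff // scale1r /D bracket_cramer dP GP.
Qed.
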